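(* (1) A tree set is isomorphic to the edge tree set $\tau(T)$ of some (graph-theoretical, possibly infinite) tree $T$ if and only if it is regular and tame. (2) Every regular tame tree set $\tau'$ is isomorphic (as a separation system) to $\tau(T(\tau'))$. (3) Every graph-theoretical tree $T'$ (possibly infinite) is isomorphic (as a graph) to $T(\tau(T'))$.
   Context: A separation system is a partially ordered set $(\vec S,\le)$ with an order-reversing involution $^*$, i.e. $\vec s\le\vec r$ iff $\vec s^{\,*}\ge \vec r^{\,*}$. Write $\overleftarrow{s}=\vec s^{\,*}$; the pair $s=\{\vec s,\overleftarrow s\}$ is an unoriented separation. $\vec s$ is small if $\vec s\le\overleftarrow s$; the system is regular if it has no small element. $\vec s$ is trivial if there is $\vec r$ with $r\neq s$ and $\vec s\le\vec r$, $\vec s\le\overleftarrow r$. Two unoriented separations are nested if they have comparable orientations; a system is nested if all pairs of its separations are nested. A tree set is a nested separation system with no trivial elements. A tree set is tame if it contains no chain of order type $\omega+1$. A homomorphism of separation systems is an order-preserving map commuting with the involution; an isomorphism is a bijection $f$ such that $f$ and $f^{-1}$ are homomorphisms. An orientation of a tree set $\tau$ is a subset $O$ containing exactly one of $\vec s,\overleftarrow s$ for each $s$; it is consistent if for all $\vec r,\vec s\in O$, $\overleftarrow s\le \vec r$ implies $r=s$. A consistent orientation is splitting if each of its elements lies below some maximal element of $O$. For $\vec s\in\tau$ (regular tame), $O(\vec s)$ denotes the unique consistent orientation in which $\vec s$ is maximal. Edge tree set of a tree $T$: $\tau(T)$ has ground set $\{(x,y): xy\in E(T)\}$, involution $(x,y)^*=(y,x)$,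 and $(x,y)<(v,w)$ iff $\{x,y\}\ne\{v,w\}$ and the unique $\{x,y\}$–$\{v,w\}$-path in $T$ joins $y$ to $v$. Tree of a regular tame tree set $\tau$: $T(\tau)$ is the graph whose vertex set is the set of splitting orientations of $\tau$ and whose edge set is $\{\{O(\vec s),O(\overleftarrow s)\}:\vec s\in\tau\}$. *)

(* Defs.v *)
From mathcomp Require Import all_boot.
From mathcomp Require Import boolp classical_sets.
From Stdlib Require Relation_Definitions List.

Set Implicit Arguments.
Unset Strict Implicit.
Unset Printing Implicit Defensive.

Local Open Scope classical_set_scope.

(* The axioms are kept apart in [separation_system], so that the edge tree set
   of a graph can be written down before it is known to satisfy them. *)
Record sep_structure := SepStructure {
  sep_carrier :> Type;
  sep_le : sep_carrier -> sep_carrier -> Prop;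
  sep_inv : sep_carrier -> sep_carrier }.

Section SeparationSystems.
Variable S : sep_structure.
Implicit Types (r s : S) (O : set S).

Definition separation_system : Prop :=
  [/\ Relation_Definitions.order S (@sep_le S),
      involutive (@sep_inv S) &
      forall r s, sep_le s r <-> sep_le (sep_inv r) (sep_inv s)].

Definition unoriented s : set S := [set s; sep_inv s].

Definition small s : Prop := sep_le s (sep_inv s).

Definition regular : Prop := forall s, ~ small s.

Definition trivial_sep s : Prop :=
  exists r, [/\ unoriented r <> unoriented s,
                sep_le s r & sep_le s (sep_inv r)].

Definition nested_seps r s : Prop :=
  exists r' s', [/\ unoriented r r', unoriented s s' &
                    sep_le r' s' \/ sep_le s' r'].

Definition tree_set : Prop :=
  [/\ separation_system,
      forall r s, nested_seps r s &
      forall s, ~ trivial_sep s].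

(* [option nat] ordered as omega + 1, with [None] on top. *)
Definition omega1_le (i j : option nat) : Prop :=
  match i, j with
  | _, None => True
  | None, Some _ => False
  | Some m, Some n => m <= n
  end.

Definition tame : Prop :=
  ~ exists c : option nat -> S,
      forall i j, sep_le (c i) (c j) <-> omega1_le i j.

Definition orientation O : Prop :=
  forall s, exists! t, unoriented s t /\ O t.

Definition consistent_orientation O : Prop :=
  orientation O /\
  forall r s, O r -> O s -> sep_le (sep_inv s) r -> unoriented r = unoriented s.

Definition maximal_in O s : Prop :=
  O s /\ forall r, O r -> sep_le s r -> r = s.

Definition splitting O : Prop :=
  consistent_orientation O /\
  forall s, O s -> exists2 m, maximal_in O m & sep_le s m.

(* [is_O s O] says O = O(s). *)
Definition is_O s : set S -> Prop :=
  unique (fun O => consistent_orientation O /\ maximal_in O s).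

End SeparationSystems.

Definition sep_hom (S S' : sep_structure) (f : S -> S') : Prop :=
  (forall r s, sep_le r s -> sep_le (f r) (f s)) /\
  (forall s, f (sep_inv s) = sep_inv (f s)).

Definition sep_isomorphic (S S' : sep_structure) : Prop :=
  exists (f : S -> S') (g : S' -> S),
    [/\ cancel f g, cancel g f, sep_hom f & sep_hom g].

(* [is_graph] requires the edges to be 2-element sets of vertices. *)
Record graph_structure := GraphStructure {
  vertex :> Type;
  edges : set (set vertex) }.

Arguments edges : clear implicits.

Section Graphs.
Variable G : graph_structure.
Implicit Types (x y : G) (p : seq G) (A B : set G).

Definition is_graph : Prop :=
  forall e, edges G e -> exists x y, x <> y /\ e = [set x; y].

Fixpoint walk p : Prop :=
  match p with
  | x :: ((y :: _) as q) => edges G [set x; y] /\ walk q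
  | _ => True
  end.

(* The path with vertex sequence x :: p, from x to last x p. *)
Definition is_path x p : Prop := walk (x :: p) /\ List.NoDup (x :: p).

Definition connected : Prop :=
  inhabited G /\ forall x y, exists2 p, is_path x p & last x p = y.

Definition acyclic : Prop :=
  ~ exists x p, [/\ is_path x p, 2 <= size p & edges G [set last x p; x]].

Definition is_tree : Prop := [/\ is_graph, connected & acyclic].

(* The path meets A exactly in its first and B exactly in its last vertex. *)
Definition set_path A B x p : Prop :=
  [/\ is_path x p,
      [set z | List.In z (x :: p)] `&` A = [set x] &
      [set z | List.In z (x :: p)] `&` B = [set last x p]].

Definition oriented_edge : Type := {e : G * G | edges G [set e.1; e.2]}.

Definition edge_lt (e f : oriented_edge) : Prop :=
  let: (x, y) := sval e in
  let: (v, w) := sval f in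
  [set x; y] <> [set v; w] /\
  exists p, [/\ set_path [set x; y] [set v; w] y p,
                forall a q, set_path [set x; y] [set v; w] a q ->
                            a = y /\ q = p &
                last y p = v].

Definition edge_le (e f : oriented_edge) : Prop := e = f \/ edge_lt e f.

Definition edge_inv (e : oriented_edge) : oriented_edge :=
  exist _ ((sval e).2, (sval e).1)
    (eq_ind _ (edges G) (svalP e) _ (setUC [set (sval e).1] [set (sval e).2])).

Definition edge_tree_set : sep_structure := SepStructure edge_le edge_inv.

End Graphs.

Definition graph_isomorphic (G H : graph_structure) : Prop :=
  exists2 f : G -> H, bijective f &
    forall x y, edges G [set x; y] <-> edges H [set f x; f y].

Definition tree_of (S : sep_structure) : graph_structure :=
  @GraphStructure {O : set S | splitting O}
    [set e | exists s O O', [/\ is_O s (sval O), is_O (sep_inv s) (sval O') &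
                               e = [set O; O']]].

(* Main.v *)
(* Removing an edge xy from a tree leaves two components, and xy is the only
   edge between them. Sending an oriented edge (x, y) to the component of y
   turns the order of the edge tree set into reverse inclusion and the
   involution into complementation. All axioms, regularity and tameness then
   reduce to this cut property: a bounded ascending chain of edges would lie on
   a single finite path.

   In a regular tree set, O(m) consists of the s other than m^* with s <= m or
   s <= m^*, so O(m) and O(m^* ) differ only in the orientation of m. Hence
   {O : s in O} is a cut of the tree of the tree set crossed only by the edge of
   s, which makes that graph acyclic and identifies its edge tree set.
   Tameness provides maximal elements above (so O(m) is splitting) and, through
   the involution, immediate successors (so the graph is connected). Conversely
   the splitting orientations of the edge tree set of a tree are exactly the
   orientations of all edges towards a fixed vertex. *)
From mathcomp Require Import all_boot.
From mathcomp Require Import boolp classical_sets.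
From Stdlib Require List FinFun.
Require Import Defs.

Set Implicit Arguments.
Unset Strict Implicit.
Unset Printing Implicit Defensive.

Local Open Scope classical_set_scope.

(** * Two-element sets and duplicate-free lists *)

Lemma set2_eq_cases (T : Type) (a b c d : T) :
  [set a; b] = [set c; d] -> (a = c /\ b = d) \/ (a = d /\ b = c).
Proof.
move=> E.
have Ha : [set c; d] a by rewrite -E; left.
have Hb : [set c; d] b by rewrite -E; right.
have Hc : [set a; b] c by rewrite E; left.
have Hd : [set a; b] d by rewrite E; right.
move: Ha Hb Hc Hd; rewrite /setU /=.
by case=> [->|->]; case=> [->|->]; case=> [?|?]; case=> [?|?];
  subst; auto.
Qed.

Lemma last_In (T : Type) (x : T) p : List.In (last x p) (x :: p).
Proof. by elim: p x => [|y p IH] x /=; [left|right; exact: IH]. Qed.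

(** Pigeonhole: the first [(size l).+1] values of [h] would be distinct entries of [l]. *)
Lemma no_injection_in_list (T : Type) (h : nat -> T) (l : seq T) :
  injective h -> ~ forall n, List.In (h n) l.
Proof.
move=> hi hl.
have := @List.NoDup_incl_length _ (List.map h (List.seq 0 (size l).+1)) l.
rewrite List.length_map List.length_seq => H.
have /leP : (size l < size l)%coq_nat.
  apply: H; first exact: FinFun.Injective_map_NoDup hi (List.seq_NoDup _ _).
  by move=> x /List.in_map_iff [n [<- _]].
by rewrite ltnn.
Qed.

Lemma NoDup_catr (T : Type) (p q : seq T) : List.NoDup (p ++ q) -> List.NoDup q.
Proof. by elim: p => [//|x p IH] /= /List.NoDup_cons_iff [_ /IH]. Qed.

Lemma NoDup_cat_disjoint (T : Type) (z : T) (p q : seq T) :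
  List.NoDup (p ++ q) -> List.In z p -> ~ List.In z q.
Proof.
elim: p => [//|x p IH] /= /List.NoDup_cons_iff [nin nd] [xz|/(IH nd)//] zq.
by apply: nin; apply/List.in_app_iff; right; rewrite xz.
Qed.

(** * Paths and cuts in graphs *)

(** The step is required only between vertices of the walk, which covers walks that avoid a given
    vertex. *)
Lemma walk_invariant (G : graph_structure) (P : set G) (a : G) (p : seq G) :
  (forall c d, List.In c (a :: p) -> List.In d (a :: p) -> edges G [set c; d] ->
     P c -> P d) ->
  walk (a :: p) -> P a -> P (last a p).
Proof.
elim: p a => [|b p IH] a //= step [ab wb] Pa.
apply: IH => //; first by move=> c d cin din; apply: step; right.
by apply: (step a) => //; [left|right; left].
Qed.

Lemma walk_catr (G : graph_structure) (p q : seq G) : walk (p ++ q) -> walk q.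
Proof.
elim: p => [//|x [|y p] IH] /=; first by case: q {IH} => [//|z q] [].
by move=> [_ /IH].
Qed.

Lemma walk_catl (G : graph_structure) (p q : seq G) : walk (p ++ q) -> walk p.
Proof. by elim: p => [//|x [|y p] IH] //= [xy /IH]. Qed.

(** If [a] already lies on the path, the part from [a] on is taken instead; paths thus grow without
    reducing walks to paths. *)
Lemma path_prepend (G : graph_structure) (a z : G) (p : seq G) :
  is_path z p -> edges G [set a; z] ->
  exists2 q, is_path a q & last a q = last z p.
Proof.
move=> [wp np] az.
case: (pselect (List.In a (z :: p))) => [ain|nin].
  have [l1 [l2 E]] := List.in_split _ _ ain.
  exists l2; last first.
    by rewrite -(last_cons z) -[RHS](last_cons z) E last_cat.
  by split; [apply: (@walk_catr _ l1)|apply: (@NoDup_catr _ l1)];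
    rewrite -[_ ++ _]E.
by exists (z :: p) => //; split=> //; apply/List.NoDup_cons_iff.
Qed.

Lemma acyclic_of_cuts (G : graph_structure) :
  (forall x y, edges G [set x; y] -> exists C : set G,
     [/\ C x, ~ C y & forall a b, edges G [set a; b] -> C a -> ~ C b ->
        [set a; b] = [set x; y]]) ->
  acyclic G.
Proof.
move=> cut [x [[|y [|z p]] [[w nd] //= _ e]]].
have [C [Cl nCx cross]] := cut _ _ e.
have [xy wy] := w.
have [nx ny] : ~ List.In x (y :: z :: p) /\ List.NoDup (y :: z :: p).
  by apply/List.NoDup_cons_iff.
have nlast : y <> last z p.
  move=> E; have : List.In (last z p) (z :: p) by exact: last_In.
  by rewrite -E; move/List.NoDup_cons_iff: ny => [].
have nCy : ~ C y.
  move=> Cy; have := cross y x; rewrite setUC => /(_ xy Cy nCx).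
  move=> E; case: (set2_eq_cases E) => [[_ yx]|[_ yl]]; last exact: nlast.
  by apply: nx; left.
(* The rest of the cycle avoids [x], so none of its edges is the closing edge and it never enters
   [C]. *)
suff : ~ C (last y (z :: p)) by [].
apply: (@walk_invariant G (~` C)) => // c d cin din cd nCc Cd.
have := cross d c; rewrite setUC => /(_ cd Cd nCc).
move=> E; case: (set2_eq_cases E) => [[E1 E2]|[E1 E2]]; apply: nx;
  by [rewrite -E1|rewrite -E2].
Qed.

(** The component of [y] after deletion of the edge [xy], given by reachability so that proofs can
    follow a walk by induction. *)
Inductive far_side (G : graph_structure) (x y : G) : set G :=
| far_side_end : far_side x y y
| far_side_step a b : far_side x y a -> edges G [set a; b] ->
    [set a; b] <> [set x; y] -> far_side x y b.

Definition del_edge (G : graph_structure) (x y : G) : graph_structure :=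
  @GraphStructure G [set e | edges G e /\ e <> [set x; y]].

Lemma far_side_path (G : graph_structure) (x y z : G) :
  far_side x y z ->
  exists2 p, @is_path (del_edge x y) z p & last z p = y.
Proof.
elim=> [|a b _ [p pp lp] ab nab].
  by exists [::] => //; split=> //; apply/List.NoDup_cons_iff; split=> //; constructor.
have ba : edges (del_edge x y) [set b; a] by rewrite setUC.
have [q pq lq] := @path_prepend (del_edge x y) b a p pp ba.
by exists q => //; rewrite -lp.
Qed.

Lemma is_path_del_edge (G : graph_structure) (x y z : G) p :
  @is_path (del_edge x y) z p -> @is_path G z p.
Proof.
move=> [w nd]; split=> //; move: w {nd}.
by elim: p z => [|b p IH] a //= [[ab _] /IH].
Qed.

(** * The two sides of an edge in a tree *)

Section Tree.
Variable G : graph_structure.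
Hypothesis treeG : is_tree G.
Implicit Types (x y z : G) (e f : oriented_edge G).

Lemma edge_irrefl x y : edges G [set x; y] -> x <> y.
Proof.
case: treeG => gr _ _ /gr [a [b [ab E]]] xy; apply: ab.
by case: (set2_eq_cases E) => -[<- <-].
Qed.

(** A path from [x] to [y] without the edge [xy] would close up with it to a cycle. *)
Lemma far_side_start x y : edges G [set x; y] -> ~ far_side x y x.
Proof.
move=> xy /far_side_path [p pp lp].
case: treeG => _ _; apply; exists x, p; split.
- exact: is_path_del_edge pp.
(* Length 0 would give [x = y], and length 1 would use the deleted edge. *)
- case: p pp lp => [|a [|b p]] //= pp lp; first by case: (edge_irrefl xy).
  by case: pp => -[[_]] /=; rewrite lp.
- by rewrite lp setUC.
Qed.

(** Retracing the walk from [x] to [z] would put [x] itself into [far_side x y]. *)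
Lemma far_side_disjoint x y z :
  edges G [set x; y] -> far_side x y z -> ~ far_side y x z.
Proof.
move=> xy fz gz; elim: gz fz => [|a b _ IH ab nab fb].
  exact: far_side_start.
apply: IH; apply: (far_side_step fb); first by rewrite setUC.
by rewrite setUC [[set x; y]]setUC.
Qed.

Lemma far_side_cover x y z :
  edges G [set x; y] -> far_side x y z \/ far_side y x z.
Proof.
move=> xy; case: treeG => _ [_ /(_ y z) [p [w _] <-]] _.
apply: (@walk_invariant G (far_side x y `|` far_side y x)) => //; last first.
  by left; exact: far_side_end.
move=> c d _ _ cd.
case: (pselect ([set c; d] = [set x; y])) => [E _|ne].
  case: (set2_eq_cases E) => -[_ ->]; first by left; exact: far_side_end.
  by right; exact: far_side_end.
case=> fc; [left|right]; apply: far_side_step fc cd _ => //.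
by rewrite [[set y; x]]setUC.
Qed.

Lemma far_sideN x y z : edges G [set x; y] -> ~ far_side x y z <-> far_side y x z.
Proof.
move=> xy; split; first by case: (far_side_cover z xy).
by move=> ? /(far_side_disjoint xy).
Qed.

Lemma far_side_cross x y a b :
  edges G [set x; y] -> edges G [set a; b] ->
  far_side x y a -> ~ far_side x y b -> a = y /\ b = x.
Proof.
move=> xy ab fa nfb.
case: (pselect ([set a; b] = [set x; y])) => [E|ne]; last first.
  by case: nfb; exact: far_side_step fa ab ne.
case: (set2_eq_cases E) => [[ax _]|//].
by case: (far_side_start xy); rewrite -{2}ax.
Qed.

(** Steps along other edges leave neither [C] nor its complement, so these contain the sides of [y]
    and [x] respectively. *)
Lemma far_side_unique (C : set G) x y :
  edges G [set x; y] -> C y -> ~ C x ->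
  (forall a b, edges G [set a; b] -> C a -> ~ C b -> [set a; b] = [set x; y]) ->
  far_side x y = C.
Proof.
move=> xy Cy nCx cross; apply/seteqP; split=> z.
  elim=> [//|a b _ Ca ab ne]; apply: contrapT => nCb.
  exact: ne (cross _ _ ab Ca nCb).
move=> Cz; apply: contrapT => /(far_sideN z xy) fz; move: Cz.
elim: fz => [//|a b _ nCa ab ne Cb]; apply: ne.
rewrite (setUC [set a]) in ab *.
by rewrite (cross b a) // (setUC [set x]).
Qed.

(** A walk from [w] off the edge [vw] could leave [far_side x y] only at [y], which lies outside
    [far_side v w]. *)
Lemma far_side_sub x y v w : edges G [set x; y] ->
  far_side x y w -> ~ far_side v w y -> far_side v w `<=` far_side x y.
Proof.
move=> xy fw ny z; elim=> [//|a b fa IH ab nab]; apply: contrapT => nb.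
have [ay _] := far_side_cross xy ab IH nb.
by apply: ny; rewrite -ay.
Qed.

Lemma walk_far_side x y a p :
  walk (a :: p) -> ~ List.In x (a :: p) \/ ~ List.In y (a :: p) ->
  far_side x y a -> far_side x y (last a p).
Proof.
move=> w nin; apply: walk_invariant => // c d cin din cd fc.
apply: (far_side_step fc cd) => E.
by case: (set2_eq_cases E) => -[E1 E2]; case: nin; apply; rewrite -?E1 -?E2.
Qed.

Lemma path_tail x y p : is_path x (y :: p) ->
  [/\ edges G [set x; y], is_path y p & ~ List.In x (y :: p)].
Proof. by move=> [[xy w] /List.NoDup_cons_iff [nin nd]]. Qed.

Lemma path_far_side x y p : is_path x (y :: p) -> far_side x y (last y p).
Proof.
move=> /path_tail [xy [w _] nin].
by apply: walk_far_side => //; [left|exact: far_side_end].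
Qed.

(** If the first steps [a] and [b] differ, one path ends beyond [xa], while the other misses [x]
    from [b] on and stays on the side of [x]. *)
Lemma path_unique x p q :
  is_path x p -> is_path x q -> last x p = last x q -> p = q.
Proof.
elim: p x q => [|a p IH] x [|b q] //= pp pq E.
- by have [_ _ []] := path_tail pq; rewrite E; exact: last_In.
- by have [_ _ []] := path_tail pp; rewrite -E; exact: last_In.
have [xa pa nxa] := path_tail pp; have [xb pb nxb] := path_tail pq.
case: (pselect (a = b)) => [ab|ab].
  by subst b; rewrite (IH a q).
have fl := path_far_side pp; rewrite E in fl.
case: (far_side_disjoint xa fl).
apply: walk_far_side; [by case: pb|by right|].
apply/(far_sideN b xa) => fb.
have [|bx] := far_side_cross xa _ fb (far_side_start xa); first by rewrite setUC.
by case: ab.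
Qed.

(** * The order of the edge tree set as reverse inclusion of sides *)

Definition head_side e : set G := far_side (sval e).1 (sval e).2.

Lemma head_side_inv e z : head_side (edge_inv e) z <-> ~ head_side e z.
Proof. by case: e => -[x y] /= xy; split=> /(far_sideN _ xy). Qed.

Lemma edge_val_inj e f : sval e = sval f -> e = f.
Proof. by case: e f => [e He] [f Hf] /= E; exact: eq_exist. Qed.

Lemma head_side_inj : injective head_side.
Proof.
move=> [[x y] xy] [[v w] vw] E; apply: edge_val_inj => /=.
rewrite /head_side /= in E.
have [|||-> ->] // := @far_side_cross v w y x vw.
- by rewrite setUC.
- by rewrite -E; exact: far_side_end.
- by rewrite -E; exact: far_side_start.
Qed.

(** The joining path meets each edge in one end only, so it misses [x] and [w]. Hence [v] and [w]
    lie beyond [xy], while [y] does not lie beyond [vw]. *)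
Lemma edge_lt_head_side e f : edge_lt e f -> head_side f `<=` head_side e.
Proof.
case: e f => [[x y] xy] [[v w] vw]; rewrite /edge_lt /head_side /=.
move=> [ne [p [[[wp ndp] Ex Ev] _ lv]]].
have nx : ~ List.In x (y :: p).
  move=> xin; apply: (edge_irrefl xy).
  have : [set y] x by rewrite -Ex; split=> //; left.
  by [].
have nw : ~ List.In w (y :: p).
  move=> win; apply: (edge_irrefl vw).
  have : [set last y p] w by rewrite -Ev; split=> //; right.
  by rewrite lv.
have fv : far_side x y v.
  by rewrite -lv; apply: walk_far_side => //; [left|exact: far_side_end].
have fw : far_side x y w by apply: far_side_step fv vw _ => E; exact: ne.
have ny : ~ far_side v w y.
  move=> fy; have : far_side v w (last y p) by apply: walk_far_side => //; right.
  by rewrite lv; exact: far_side_start.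
exact: far_side_sub.
Qed.

(** The path from [y] to [v] is the joining path: the sides of the two edges keep it off [x] and [w]
    and exclude other end vertices. *)
Lemma head_side_edge_lt e f :
  head_side f `<=` head_side e -> e <> f -> edge_lt e f.
Proof.
case: e f => [[x y] xy] [[v w] vw]; rewrite /edge_lt /head_side /= => sub nef.
have ne : [set x; y] <> [set v; w].
  move=> E; case: (set2_eq_cases E) => -[E1 E2]; subst.
    by apply: nef; exact: edge_val_inj.
  by apply: (far_side_start xy); apply: sub; exact: far_side_end.
have fw : far_side x y w by apply: sub; exact: far_side_end.
have fv : far_side x y v.
  apply: (far_side_step fw); first by rewrite setUC.
  by rewrite setUC => E; exact: ne.
have nx : ~ far_side v w x by move=> /sub; exact: far_side_start.
have ny : ~ far_side v w y.
  move=> fy; apply: nx; apply: (far_side_step fy); first by rewrite setUC.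
  by rewrite setUC.
(* A walk from the side of [v] reaches [w] only through [v]. *)
have tail a q : walk (a :: q) -> ~ far_side v w a -> ~ List.In v (a :: q) ->
    last a q <> w.
  move=> wq na nv E; have : far_side w v (last a q).
    by apply: walk_far_side => //; [right|apply/(far_sideN a vw)].
  by rewrite E => /(far_sideN w vw); apply; exact: far_side_end.
split=> //.
have [p [wp ndp] lv] : exists2 p, is_path y p & last y p = v.
  by case: treeG => _ [_ c] _; exact: c.
have nxp : ~ List.In x (y :: p).
  case=> [yx|xin]; first by case: (edge_irrefl xy).
  have [l1 [l2 E]] := List.in_split _ _ xin.
  have [w2 nyl] : walk (x :: l2) /\ ~ List.In y (x :: l2).
    split; first by apply: (@walk_catr _ (y :: l1)); rewrite /= -[_ ++ _]E.
    apply: (@NoDup_cat_disjoint _ _ (y :: l1)); last by left.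
    by rewrite /= -[_ ++ _]E.
  (* The part of the path from [x] on misses [y], so it would end on the side of [x]. *)
  apply: (far_side_disjoint xy fv).
  have -> : v = last x l2 by rewrite -lv E last_cat.
  by apply: walk_far_side => //; [left|exact: far_side_end].
have nwp : ~ List.In w (y :: p).
  case=> [yw|win]; first by apply: ny; rewrite yw; exact: far_side_end.
  have [l1 [l2 E]] := List.in_split _ _ win.
  have E' : y :: p = (y :: rcons l1 w) ++ l2 by rewrite E /= cat_rcons.
  have vl2 : List.In v l2.
    have : v = last w l2 by rewrite -lv E last_cat.
    case: (l2) => [|b l] /= vE; first by case: (edge_irrefl vw).
    by rewrite vE; exact: last_In.
  apply: (tail y (rcons l1 w)) => //.
  - by apply: (@walk_catl _ _ l2); rewrite -E'.
  - by move=> /(@NoDup_cat_disjoint _ _ _ l2); apply=> //; rewrite -E'.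
  - by rewrite last_rcons.
exists p; split=> //.
  split=> //; apply/seteqP; split=> z /=.
  - by move=> [zin [zx|//]]; case: nxp; rewrite -zx.
  - by move=> ->; split; [left|right].
  - by move=> [zin [zv|zw]]; [rewrite lv|case: nwp; rewrite -zw].
  - by rewrite lv => ->; split; [rewrite -lv; exact: last_In|left].
move=> a q [pq Ea El].
have [_ alt] : ([set z | List.In z (a :: q)] `&` [set x; y]) a by rewrite Ea.
have [_ llt] : ([set z | List.In z (a :: q)] `&` [set v; w]) (last a q).
  by rewrite El.
have ay : a = y.
  case: alt => [/= ax|//]; subst a.
  have nyq : ~ List.In y (x :: q).
    move=> yin; apply: (edge_irrefl xy).
    suff : [set x] y by [].
    by rewrite -Ea; split=> //; right.
  (* Started at [x], the path stays on the side of [x], but [v] and [w] both lie on the side of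
     [y]. *)
  have fl : far_side y x (last x q).
    by case: pq => wq _; apply: walk_far_side => //; [left|exact: far_side_end].
  case: llt fl => /= -> fl; first by case: (far_side_disjoint xy fv fl).
  by case: (far_side_disjoint xy fw fl).
subst a; split=> //; apply: (path_unique pq) => //.
rewrite lv; case: llt => [//|/= lw].
case: (tail y q) => //; first by case: pq.
move=> vin; apply: (edge_irrefl vw).
suff : [set last y q] v by rewrite lw.
by rewrite -El; split=> //; left.
Qed.

Lemma edge_leP e f : edge_le e f <-> head_side f `<=` head_side e.
Proof.
split; first by case=> [->//|]; exact: edge_lt_head_side.
by move=> sub; case: (pselect (e = f)) => [|ne]; [left|right; exact: head_side_edge_lt].
Qed.

Lemma head_side_head e : head_side e (sval e).2.
Proof. exact: far_side_end. Qed.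

(** * Edge tree sets of trees are regular tame tree sets *)

Lemma edge_invK : involutive (@edge_inv G).
Proof. by move=> e; apply: edge_val_inj; case: e => -[]. Qed.

Lemma edge_separation_system : separation_system (edge_tree_set G).
Proof.
split.
- split=> [e|e f g|e f]; first by left.
    by move=> /edge_leP ef /edge_leP fg; apply/edge_leP => z /fg /ef.
  move=> /edge_leP ef /edge_leP fe.
  by apply: head_side_inj; apply/seteqP.
- exact: edge_invK.
- move=> r s; split=> /edge_leP sub; apply/edge_leP => z.
    by move=> /head_side_inv nz; apply/head_side_inv => /sub.
  move=> rz; apply: contrapT => /head_side_inv /sub /head_side_inv.
  exact.
Qed.

Lemma edge_regular : regular (edge_tree_set G).
Proof.
move=> s /edge_leP sub.
have h := head_side_head (edge_inv s).
by have /head_side_inv := h; apply; exact: sub.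
Qed.

(** Orient [r] towards the head of [s], and [s] away from the head of [r']. Either [far_side_sub]
    gives [r' <= s'], or the ends of [s] lie on different sides of [r'] and [r' = s]. *)
Lemma edge_nested (r s : edge_tree_set G) : nested_seps r s.
Proof.
have [r' rr' r'w] : exists2 r', unoriented r r' & head_side r' (sval s).2.
  case: (pselect (head_side r (sval s).2)) => h; first by exists r => //; left.
  by exists (edge_inv r); [right|apply/head_side_inv].
have [s' ss' s'y] : exists2 s', unoriented s s' & ~ head_side s' (sval r').2.
  case: (pselect (head_side s (sval r').2)) => h; last by exists s => //; left.
  by exists (edge_inv s); [right|move=> /head_side_inv].
case: (pselect (head_side r' (sval s').2)) => h.
  exists r', s'; split=> //; left; apply/edge_leP.
  by apply: far_side_sub => //; exact: (svalP r').
exists r', s; split=> //; first by left.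
case: ss' => /= s's; first by case: h; rewrite s's.
left; left; apply: edge_val_inj; subst s'; move: r'w h.
case: (r') (s) => -[x y] xy [[v w] vw]; rewrite /head_side /= => fw nv.
have [|-> ->] := far_side_cross xy _ fw nv => //.
by rewrite setUC.
Qed.

Lemma edge_tree_set_tree_set : tree_set (edge_tree_set G).
Proof.
split; [exact: edge_separation_system|exact: edge_nested|].
move=> s [r [_ /edge_leP sr /edge_leP sr']].
(* The tail of [s] lies on one of the sides of [r], and both are contained in the head side of
   [s]. *)
suff : head_side s (sval s).1.
  by case: (s) => -[x y] /= xy; exact: far_side_start.
case: (pselect (head_side r (sval s).1)) => [/sr//|/head_side_inv].
exact: sr'.
Qed.

(* Every edge of an ascending chain bounded above separates the tail of its
   first edge from the head of the bound, so it lies on the path joining them. *)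
Lemma edge_tame : tame (edge_tree_set G).
Proof.
move=> [c cP].
have [p [w _] lp] : exists2 p, is_path (sval (c (Some 0))).1 p &
    last (sval (c (Some 0))).1 p = (sval (c None)).2.
  by case: treeG => _ [_ con] _; exact: con.
set l := _ :: p in w.
apply: (@no_injection_in_list _ (fun n => sval (c (Some n))) (List.list_prod l l)).
  move=> i j /edge_val_inj E; apply/eqP; rewrite eqn_leq.
  by apply/andP; split; [apply: (cP (Some i) (Some j)).1|
    apply: (cP (Some j) (Some i)).1]; rewrite E; left.
move=> n; have h0 : ~ head_side (c (Some n)) (sval (c (Some 0))).1.
  have /edge_leP sub : edge_le (c (Some 0)) (c (Some n)) by apply/cP.
  move=> /sub; case: (c (Some 0)) => -[x y] /= xy; exact: far_side_start.
have hn : head_side (c (Some n)) (sval (c None)).2.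
  have /edge_leP sub : edge_le (c (Some n)) (c None) by apply/cP.
  by apply: sub; exact: head_side_head.
rewrite [sval (c _)]surjective_pairing; apply/List.in_prod_iff.
move: h0 hn; rewrite -lp; case: (c (Some n)) => -[x y] xy.
rewrite /head_side /= => /(far_sideN _ xy) h0 hn.
split; apply: contrapT => nin;
  apply: (far_side_disjoint xy hn); apply: walk_far_side => //;
  by [left|right].
Qed.

End Tree.

(** * Consistent orientations of regular tree sets *)

Section TreeSet.
Variable S : sep_structure.
Hypotheses (treeS : tree_set S) (regS : regular S).
Implicit Types (r s t m : S) (O : set S).

Local Notation le := (@sep_le S).
Local Notation inv := (@sep_inv S).

Lemma sle_refl s : le s s.
Proof. by case: treeS => -[[]]. Qed.

Lemma sle_trans s r t : le r s -> le s t -> le r t.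
Proof. by case: treeS => -[[_ tr _] _ _] _ _; exact: tr. Qed.

Lemma sle_anti r s : le r s -> le s r -> r = s.
Proof. by case: treeS => -[[_ _ an] _ _] _ _; exact: an. Qed.

Lemma sinvK : involutive inv.
Proof. by case: treeS => -[]. Qed.

Lemma sle_inv r s : le s r -> le (inv r) (inv s).
Proof. by case: treeS => -[_ _ H] _ _ /H. Qed.

Lemma sle_invl r s : le (inv s) r -> le (inv r) s.
Proof. by move=> /sle_inv; rewrite sinvK. Qed.

Lemma sle_invr r s : le s (inv r) -> le r (inv s).
Proof. by move=> /sle_inv; rewrite sinvK. Qed.

Lemma unoriented_eqP r s : unoriented r = unoriented s -> r = s \/ r = inv s.
Proof. by move=> E; have : unoriented s r by rewrite -E; left. Qed.

(** If [r] is an orientation of the same separation, [s] is small; otherwise it is trivial. *)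
Lemma sle_both r s : le s r -> le s (inv r) -> False.
Proof.
move=> sr sr'; case: treeS => _ _ /(_ s); apply; exists r; split=> // E.
by case: (unoriented_eqP E) => rE; subst r; apply: (regS (s := s)).
Qed.

Lemma sge_both r s : le r s -> le (inv r) s -> False.
Proof. by move=> /sle_inv rs /sle_inv; exact: sle_both. Qed.

Lemma sle_cases r s : [\/ le r s, le r (inv s), le s r | le (inv s) r].
Proof.
case: treeS => _ /(_ r s) [r' [s' [[->|->] [->|->] [h|h]]]] _.
- by constructor 1.
- by constructor 3.
- by constructor 2.
- by constructor 4.
- by constructor 4; exact: sle_invl.
- by constructor 2; exact: sle_invr.
- by constructor 3; move: (sle_inv h); rewrite !sinvK.
- by constructor 1; move: (sle_inv h); rewrite !sinvK.
Qed.

Lemma sinv_neq s : s <> inv s.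
Proof. by move=> E; apply: (regS (s := s)); rewrite /small -E; exact: sle_refl. Qed.

Lemma orientationP O :
  orientation O <-> forall s, (O s \/ O (inv s)) /\ ~ (O s /\ O (inv s)).
Proof.
split=> [H s|H s].
  have [t [[ut Ot] un]] := H s; split.
    by case: ut Ot => ->; [left|right].
  move=> [Os Os']; apply: (@sinv_neq s).
  by rewrite -[LHS](un s) ?[LHS](un (inv s)) //; split=> //; [right|left].
have [[Os|Os] nb] := H s.
- exists s; split; first by split=> //; left.
  by move=> t [[-> //|->] Ot]; case: nb.
- exists (inv s); split; first by split=> //; right.
  by move=> t [[->|-> //] Ot]; case: nb.
Qed.

Lemma orientationN O s : orientation O -> ~ O s <-> O (inv s).
Proof.
move=> /orientationP /(_ s) [tot nb]; split; first by case: tot.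
by move=> Os' Os; exact: nb.
Qed.

Definition orientation_at m : set S :=
  [set s | s <> inv m /\ (le s m \/ le s (inv m))].

Lemma orientation_at_self m : orientation_at m m.
Proof. by split; [exact: sinv_neq|left; exact: sle_refl]. Qed.

Lemma orientation_atN m : ~ orientation_at (inv m) m.
Proof. by case=> ne _; apply: ne; rewrite sinvK. Qed.

Lemma orientation_at_consistent m : consistent_orientation (orientation_at m).
Proof.
split.
  apply/orientationP => s; split.
    case: (pselect (s = inv m)) => [->|ne].
      by right; rewrite sinvK; exact: orientation_at_self.
    case: (pselect (s = m)) => [->|ne'].
      by left; exact: orientation_at_self.
    have ne2 : inv s <> inv m by move=> /(congr1 inv); rewrite !sinvK.
    case: (sle_cases s m) => h.
    - by left; split=> //; left.
    - by left; split=> //; right.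
    - by right; split=> //; right; exact: sle_inv.
    - by right; split=> //; left; exact: sle_invl.
  move=> [[ns [h|h]] [ns' [h'|h']]].
  - exact: sge_both h h'.
  - by apply: ns'; congr inv; apply: sle_anti => //; move: (sle_inv h'); rewrite !sinvK.
  - by apply: ns; apply: sle_anti => //; exact: sle_invl.
  - exact: sge_both h h'.
move=> r s [nr hr] [ns hs] sr; exfalso.
case: hr hs => [/(sle_trans sr) h|rm] [h'|h'].
- exact: sge_both h' h.
- by apply: ns; apply: sle_anti => //; exact: sle_invl.
- have h := sle_trans sr rm.
  have sm : s = m.
    by apply: sle_anti => //; move: (sle_inv h); rewrite !sinvK.
  by apply: nr; apply: sle_anti => //; rewrite -sm.
- exact: sge_both h' (sle_trans sr rm).
Qed.

Lemma orientation_at_maximal m : maximal_in (orientation_at m) m.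
Proof.
split; first exact: orientation_at_self.
move=> r [_ [rm|rm]] mr; first exact: sle_anti.
by case: (regS (sle_trans mr rm)).
Qed.

(** Consistency forces into [O] what lies below [m]; if [s] is below [inv m] and [inv s] were in
    [O], maximality of [m] would give [inv s = m]. *)
Lemma orientation_at_unique O m :
  consistent_orientation O -> maximal_in O m -> O = orientation_at m.
Proof.
move=> [oO cO] [Om mx].
have sub : orientation_at m `<=` O.
  move=> s [ns hs]; apply: contrapT => /(orientationN s oO) Os'.
  case: hs => hs.
    have /unoriented_eqP : unoriented m = unoriented (inv s).
      by apply: cO => //; rewrite sinvK.
    rewrite sinvK => -[E|E]; subst m; first exact: (regS (s := s)).
    exact: (orientationN s oO).2 Os' Om.
  by apply: ns; rewrite -(mx (inv s)) ?sinvK //; exact: sle_invr.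
apply/seteqP; split=> // s Os; apply: contrapT.
have [oA _] := orientation_at_consistent m.
by move=> /(orientationN s oA) /sub /(orientationN s oO).
Qed.

Lemma is_OP s O : is_O s O <-> O = orientation_at s.
Proof.
have H : consistent_orientation (orientation_at s) /\
    maximal_in (orientation_at s) s.
  by split; [exact: orientation_at_consistent|exact: orientation_at_maximal].
split; first by move=> [_ un]; exact: un.
move=> ->; split=> // O' [cO' mO'].
by rewrite (orientation_at_unique cO' mO').
Qed.

Lemma orientation_at_cross r s :
  orientation_at r s -> ~ orientation_at (inv r) s -> s = r.
Proof.
move=> [_ h] n; apply: contrapT => ne; apply: n; split; rewrite sinvK //.
by case: h; [right|left].
Qed.

Lemma consistent_down O r s : consistent_orientation O -> O r -> le s r -> O s.
Proof.
move=> [oO cO] Or sr; apply: contrapT => ns.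
have Os' := (orientationN s oO).1 ns.
have /unoriented_eqP : unoriented r = unoriented (inv s).
  by apply: cO => //; rewrite sinvK.
by rewrite sinvK => -[E|E]; subst r; [exact: (regS (s := s))|].
Qed.

(** An element of [orientation_at (inv t')] above [t] is below [t'], or else [t] would be below both
    [t'] and [inv t']; so [t] is maximal there. *)
Lemma orientation_at_cover t t' : le t t' -> t <> t' ->
  (forall u, le t u -> le u t' -> u = t \/ u = t') ->
  orientation_at (inv t') = orientation_at t.
Proof.
move=> tt' ne cov; apply: orientation_at_unique.
  exact: orientation_at_consistent.
split; first by split; rewrite ?sinvK //; right.
move=> u []; rewrite sinvK => nu [h|h] tu.
  by case: (sle_both tt' (sle_trans tu h)).
by case: (cov u tu h).
Qed.

Lemma consistent_sub_eq O O' : consistent_orientation O ->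
  consistent_orientation O' -> O `<=` O' -> O = O'.
Proof.
move=> [oO _] [oO' _] sub; apply/seteqP; split=> // s Os'; apply: contrapT.
by move=> /(orientationN s oO) /sub /(orientationN s oO').
Qed.

Lemma splitting_at O s : splitting O -> O s ->
  exists2 m, O = orientation_at m & le s m.
Proof.
move=> [cO mO] /mO [m mm sm]; exists m => //.
exact: orientation_at_unique.
Qed.

(** * Extremal elements from tameness *)

Hypothesis tameS : tame S.

(** Otherwise iterated choice gives a strictly ascending sequence in [A], which together with its
    bound [m] is a chain of type omega + 1. *)
Lemma exists_maximal (A : set S) m :
  A !=set0 -> (forall a, A a -> le a m) -> exists a, maximal_in A a.
Proof.
move=> [a0 Aa0] bnd; apply: contrapT => nomax.
have /choice [g gP] : forall a, exists b, A a -> [/\ A b, le a b & b <> a].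
  move=> a; apply: contrapT => nb; apply: nomax; exists a.
  split; first by apply: contrapT => na; apply: nb; exists a.
  by move=> b Ab ab; apply: contrapT => ne; apply: nb; exists b.
pose c n := iter n g a0.
have cA n : A (c n) by elim: n => [//|n /gP []].
have cS n : le (c n) (c n.+1) by case: (gP _ (cA n)).
have cne n : c n.+1 <> c n by case: (gP _ (cA n)).
have cle i j : i <= j -> le (c i) (c j).
  elim: j => [|j IH]; first by rewrite leqn0 => /eqP ->; exact: sle_refl.
  rewrite leq_eqVlt => /orP [/eqP ->|/IH h]; first exact: sle_refl.
  exact: sle_trans h (cS j).
apply: tameS; exists (fun o => if o is Some n then c n else m).
move=> [i|] [j|] /=; split=> // h.
- rewrite leqNgt; apply/negP => ji; apply: (cne j).
  by apply: sle_anti => //; apply: sle_trans h; exact: cle.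
- exact: cle.
- exact: bnd.
- by apply: (cne j); apply: sle_anti => //; apply: sle_trans h; exact: bnd.
- exact: sle_refl.
Qed.

Lemma exists_minimal (A : set S) m : A !=set0 -> (forall a, A a -> le m a) ->
  exists2 a, A a & forall b, A b -> le b a -> b = a.
Proof.
move=> [a0 Aa0] bnd.
have [||a [Aa mx]] := @exists_maximal [set s | A (inv s)] (inv m).
- by exists (inv a0); rewrite /= sinvK.
- by move=> a /bnd; exact: sle_invr.
exists (inv a) => // b Ab ba.
by rewrite -(mx (inv b)) /= ?sinvK //; exact: sle_invr.
Qed.

(** If [r] is not below [s], then all elements above [r] in the orientation are below [inv s], and
    tameness yields a maximal one. *)
Lemma orientation_at_splitting s : splitting (orientation_at s).
Proof.
split; first exact: orientation_at_consistent.
move=> r Or; case: (pselect (le r s)) => rs.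
  by exists s => //; exact: orientation_at_maximal.
have [||a [[Oa ra] mx]] :=
    @exists_maximal [set t | orientation_at s t /\ le r t] (inv s).
- by exists r; split=> //; exact: sle_refl.
- by move=> a [[_ [h|//]] ra]; case: rs; exact: sle_trans ra h.
exists a => //; split=> // b Ob ab; apply: mx => //; split=> //.
exact: sle_trans ra ab.
Qed.

(** * The tree of a regular tame tree set *)

Definition vertex_at s : tree_of S :=
  exist _ (orientation_at s) (orientation_at_splitting s).

Lemma tree_of_vertex_inj (P Q : tree_of S) : sval P = sval Q -> P = Q.
Proof. by case: P Q => [P HP] [Q HQ] /= E; exact: eq_exist. Qed.

Lemma tree_of_edge s : edges (tree_of S) [set vertex_at s; vertex_at (inv s)].
Proof. by exists s, (vertex_at s), (vertex_at (inv s)); split=> //; apply/is_OP. Qed.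

Lemma tree_of_edgeP (P Q : tree_of S) : edges (tree_of S) [set P; Q] ->
  exists2 s, P = vertex_at s & Q = vertex_at (inv s).
Proof.
move=> [s [O [O' [/is_OP EO /is_OP EO' E]]]].
have {}EO : O = vertex_at s by exact: tree_of_vertex_inj.
have {}EO' : O' = vertex_at (inv s) by exact: tree_of_vertex_inj.
case: (set2_eq_cases E) => -[-> ->]; first by exists s.
by exists (inv s); rewrite ?sinvK.
Qed.

Lemma tree_of_cross (P Q : tree_of S) s : edges (tree_of S) [set P; Q] ->
  sval P s -> ~ sval Q s -> P = vertex_at s /\ Q = vertex_at (inv s).
Proof.
move=> /tree_of_edgeP [r -> ->] /= Ps nQs.
by rewrite (orientation_at_cross Ps nQs).
Qed.

Lemma tree_of_is_graph : is_graph (tree_of S).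
Proof.
move=> e [s [O [O' [/is_OP EO /is_OP EO' ->]]]]; exists O, O'; split=> // E.
by apply: (@orientation_atN s); rewrite -EO' -E EO; exact: orientation_at_self.
Qed.

Lemma tree_of_acyclic : acyclic (tree_of S).
Proof.
apply: acyclic_of_cuts => P Q /tree_of_edgeP [s -> ->].
exists [set R : tree_of S | sval R s]; split=> /=.
- exact: orientation_at_self.
- exact: orientation_atN.
- by move=> a b ab as_ bs; have [-> ->] := tree_of_cross ab as_ bs.
Qed.

(* Consecutive elements t < t' of the interval below m satisfy
   O(t) = O(t'^* ), so that climbing from t to m is a walk in the tree. *)
Lemma tree_of_interval_path t m : le t m ->
  exists2 p, is_path (vertex_at (inv t)) p &
    last (vertex_at (inv t)) p = vertex_at m.
Proof.
pose good t := exists2 p, is_path (vertex_at (inv t)) p &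
    last (vertex_at (inv t)) p = vertex_at m.
move=> tm; apply: contrapT => bad.
(* Maximal counterexample [a]: its immediate successor [b] below [m] is good, and one edge joins its
   path to [a]. *)
have [||a [[am bada] mx]] :=
    @exists_maximal [set u | le u m /\ ~ good u] m; first by exists t.
  by move=> a [].
have edge_a : edges (tree_of S) [set vertex_at (inv a); vertex_at a].
  by rewrite setUC; exact: tree_of_edge.
apply: bada; rewrite /good; case: (pselect (a = m)) => [<-|ne].
  apply: (@path_prepend _ _ (vertex_at a) [::]) => //.
  by split=> //; constructor => //; constructor.
have [||b [ab nab bm] mn] :=
    @exists_minimal [set u | [/\ le a u, u <> a & le u m]] a.
- by exists m; split=> //; [move=> /esym|exact: sle_refl].
- by move=> u [].
have [p pp lp] : good b.
  by apply: contrapT => badb; apply: nab; apply: mx.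
have Eb : vertex_at (inv b) = vertex_at a.
  apply: tree_of_vertex_inj; apply: orientation_at_cover => //.
    by move=> /esym.
  move=> u au ub; case: (pselect (u = a)) => [|nu]; first by left.
  by right; apply: mn => //; split=> //; exact: sle_trans ub bm.
rewrite -lp; apply: path_prepend => //; rewrite Eb.
exact: edge_a.
Qed.

Lemma tree_of_connected : connected (tree_of S).
Proof.
split.
  (* For empty [S] the empty orientation is a vertex. *)
  case: (pselect (inhabited S)) => [[s]|ni]; first by constructor; exact: vertex_at s.
  have sp : splitting (set0 : set S).
    by split; [split|] => s; case: ni; constructor.
  by constructor; exact: exist _ set0 sp.
move=> P Q; have cP := (svalP P).1; have cQ := (svalP Q).1.
case: (pselect (P = Q)) => [->|ne].
  by exists [::] => //; split=> //; constructor => //; constructor.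
have [s Qs nPs] : exists2 s, sval Q s & ~ sval P s.
  apply: contrapT => nex; apply: ne; apply/esym; apply: tree_of_vertex_inj.
  apply: consistent_sub_eq => // s Qs; apply: contrapT => nPs.
  by apply: nex; exists s.
(* With [P] at [n] and [Q] at [m], this gives [inv n <= s <= m]: the path climbs from [inv n] to
   [m]. *)
have [m EQ sm] := splitting_at (svalP Q) Qs.
have [n EP sn] := splitting_at (svalP P) ((orientationN s cP.1).1 nPs).
have {}EQ : Q = vertex_at m by exact: tree_of_vertex_inj.
have {}EP : P = vertex_at (inv (inv n)).
  by apply: tree_of_vertex_inj; rewrite /= sinvK.
rewrite EP EQ; apply: tree_of_interval_path.
exact: sle_trans (sle_invl sn) sm.
Qed.

Lemma tree_of_is_tree : is_tree (tree_of S).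
Proof.
split; [exact: tree_of_is_graph|exact: tree_of_connected|exact: tree_of_acyclic].
Qed.

(** * The isomorphism onto the edge tree set of the tree *)

Lemma tree_of_edge_inv s :
  edges (tree_of S) [set vertex_at (inv s); vertex_at s].
Proof. by rewrite setUC; exact: tree_of_edge. Qed.

(** Directed into [vertex_at s], so that the head side consists of the orientations containing
    [s]. *)
Definition edge_at s : edge_tree_set (tree_of S) :=
  exist _ (vertex_at (inv s), vertex_at s) (tree_of_edge_inv s).

Lemma head_side_edge_at s : head_side (edge_at s) = [set P | sval P s].
Proof.
apply: (far_side_unique tree_of_is_tree) => /=.
- exact: tree_of_edge_inv.
- exact: orientation_at_self.
- exact: orientation_atN.
- move=> a b ab as_ bs; have [-> ->] := tree_of_cross ab as_ bs.
  by rewrite setUC.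
Qed.

Lemma edge_at_le r s : sep_le (edge_at r) (edge_at s) <-> le r s.
Proof.
have leP := edge_leP tree_of_is_tree (edge_at r) (edge_at s).
rewrite !head_side_edge_at in leP; split.
  (* Testing at [vertex_at s] leaves [r <= inv s] as the only other case, which testing at
     [vertex_at (inv r)] refutes. *)
  move=> /leP sub; have := sub (vertex_at s) (orientation_at_self s).
  move=> [nrs [//|rs]]; exfalso.
  apply: (@orientation_atN r); apply: (sub (vertex_at (inv r))).
  split; first by rewrite sinvK => sr; move: rs; rewrite sr; exact: regS.
  by left; exact: sle_invr.
move=> rs; apply/leP => P /= Ps; apply: consistent_down Ps rs.
by case: (svalP P).
Qed.

Lemma edge_at_inv s : edge_at (inv s) = sep_inv (edge_at s).
Proof. by apply: edge_val_inj => /=; rewrite sinvK. Qed.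

Lemma edge_at_inj : injective edge_at.
Proof.
move=> r s E; apply: sle_anti; apply/edge_at_le; rewrite E;
  by apply/edge_at_le; exact: sle_refl.
Qed.

Lemma edge_at_surj e : exists s, edge_at s = e.
Proof.
case: e => -[P Q] PQ.
have [s /= EP EQ] := tree_of_edgeP PQ; exists (inv s).
by apply: edge_val_inj; rewrite /= sinvK EQ EP.
Qed.

Lemma edge_tree_set_tree_of : sep_isomorphic S (edge_tree_set (tree_of S)).
Proof.
have /choice [g gK] := edge_at_surj.
exists edge_at, g; split=> //.
- by move=> s; apply: edge_at_inj; rewrite gK.
- by split; [move=> r s /edge_at_le|exact: edge_at_inv].
- split=> [r s rs|s]; first by apply/edge_at_le; rewrite !gK.
  by apply: edge_at_inj; rewrite edge_at_inv !gK.
Qed.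

End TreeSet.

(** * The tree of an edge tree set *)

Section TreeOfEdgeTreeSet.
Variable G : graph_structure.
Hypothesis treeG : is_tree G.
Implicit Types (x y z : G).

Local Notation tau := (edge_tree_set G).

Definition towards z : set tau := [set e | head_side e z].

Lemma towards_consistent z : consistent_orientation (towards z).
Proof.
split.
  apply/(orientationP (edge_tree_set_tree_set treeG) (edge_regular treeG)) => e.
  rewrite /towards /=; split.
    by case: (pselect (head_side e z)); [left|right; apply/head_side_inv].
  by move=> [h /(head_side_inv treeG)].
move=> r s rz sz /(edge_leP treeG) sub.
by have /(head_side_inv treeG) := sub _ rz.
Qed.

(** The head side of any larger element contains the head of [e] but not its tail, so [e] crosses
    that cut and equals the element. *)
Lemma towards_maximal (e : tau) : maximal_in (towards (sval e).2) e.
Proof.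
split; first exact: head_side_head.
case: e => -[x y] xy [[v w] vw] fz /(edge_leP treeG) sub.
apply: edge_val_inj => /=.
have [|||-> ->] // := @far_side_cross _ treeG v w y x vw; first by rewrite setUC.
by move=> /sub; exact: far_side_start.
Qed.

Lemma towards_at (e : tau) : towards (sval e).2 = orientation_at e.
Proof.
apply: orientation_at_unique; [exact: edge_tree_set_tree_set|exact: edge_regular|..].
  exact: towards_consistent.
exact: towards_maximal.
Qed.

Lemma exists_edge_towards x y :
  x <> y -> exists2 e : tau, (sval e).1 = x & towards y e.
Proof.
case: treeG => _ [_ /(_ x y) [[|u p] pp <-]] _ //= _.
have [xu _ _] := path_tail pp.
exists (exist (fun e => edges G [set e.1; e.2]) (x, u) xu) => //.
exact: path_far_side.
Qed.

Lemma towards_inj : injective towards.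
Proof.
move=> x y E; apply: contrapT => /exists_edge_towards [e ex].
by rewrite -E -ex; case: e {ex} => -[a b] ab; exact: far_side_start.
Qed.

(** Any edge in [towards z] has its tail off [z], so some edge [f] leaves [z], and [towards z] is
    the orientation at its inverse. *)
Lemma towards_splitting z : splitting (towards z).
Proof.
split; first exact: towards_consistent.
move=> e ez; have /exists_edge_towards [f fz _] : z <> (sval e).1.
  by move: ez; case: e => -[x y] xy /= ez E; move: ez; rewrite E; exact: far_side_start.
have Ez : towards z = orientation_at (sep_inv f).
  by rewrite -towards_at /= fz.
have [_ sp] : splitting (towards z).
  rewrite Ez; apply: orientation_at_splitting.
  - exact: edge_tree_set_tree_set.
  - exact: edge_regular.
  - exact: edge_tame.
exact: sp.
Qed.

Lemma towards_surj (O : set tau) : splitting O -> exists z, towards z = O.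
Proof.
move=> sO; have treeT := edge_tree_set_tree_set treeG.
have regT := edge_regular treeG.
case: (pselect (exists e, O e)) => [[e Oe]|nO].
  have [m -> _] := splitting_at treeT regT sO Oe.
  by exists (sval m).2; rewrite towards_at.
(* An empty orientation means that the tree has no edges, so any vertex serves. *)
case: treeG => _ [[z] _] _; exists z; apply/seteqP; split=> e ez.
  case: nO; case: sO => -[/(orientationP treeT regT) /(_ e) [[h|h] _] _] _.
    by exists e.
  by exists (sep_inv e).
by case: nO; exists e.
Qed.

Definition towards_vertex z : tree_of tau := exist _ (towards z) (towards_splitting z).

Lemma tree_of_edge_tree_set : graph_isomorphic G (tree_of tau).
Proof.
have treeT := edge_tree_set_tree_set treeG.
have regT := edge_regular treeG; have tameT := edge_tame treeG.
have atE (e : tau) : towards_vertex (sval e).2 = vertex_at treeT regT tameT e.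
  by apply: tree_of_vertex_inj; rewrite /= towards_at.
have inj : injective towards_vertex.
  by move=> x y /(congr1 sval); exact: towards_inj.
exists towards_vertex.
  have /choice [g gK] : forall P : tree_of tau, exists z, towards_vertex z = P.
    move=> P; have [z E] := towards_surj (svalP P); exists z.
    exact: tree_of_vertex_inj.
  by exists g => // z; apply: inj; rewrite gK.
move=> x y; split=> [xy|/(tree_of_edgeP treeT regT tameT) [e Ex Ey]].
  pose e : tau := exist (fun e => edges G [set e.1; e.2]) (x, y) xy.
  have -> : towards_vertex y = vertex_at treeT regT tameT e by rewrite -atE.
  have -> : towards_vertex x = vertex_at treeT regT tameT (sep_inv e).
    by rewrite -atE.
  by rewrite setUC; exact: tree_of_edge.
have -> : x = (sval e).2 by apply: inj; rewrite atE.
have -> : y = (sval e).1 by apply: inj; rewrite Ey -atE.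
by rewrite setUC; exact: (svalP e).
Qed.

End TreeOfEdgeTreeSet.

(** * Transfer along isomorphisms and conclusion *)

Lemma sep_isomorphic_regular_tame (S S' : sep_structure) :
  sep_isomorphic S S' -> regular S' -> tame S' -> regular S /\ tame S.
Proof.
move=> [f [g [fK gK [fle finv] [gle _]]]] regS' tameS'; split.
  by move=> s /fle; rewrite finv; exact: regS'.
move=> [c cP]; apply: tameS'; exists (f \o c) => i j; split=> [/gle|/cP].
  by rewrite /= !fK => /cP.
exact: fle.
Qed.

(* In (2) and (3) the first conjuncts say that the constructions are defined:
   T(tau') is a tree, and tau(T') is a regular tame tree set. *)
Theorem theorem3p9 :
  (forall tau : sep_structure, tree_set tau ->
     ((exists T : graph_structure,
         is_tree T /\ sep_isomorphic tau (edge_tree_set T)) <->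
      (regular tau /\ tame tau))) /\
  (forall tau' : sep_structure, tree_set tau' -> regular tau' -> tame tau' ->
     is_tree (tree_of tau') /\
     sep_isomorphic tau' (edge_tree_set (tree_of tau'))) /\
  (forall T' : graph_structure, is_tree T' ->
     (tree_set (edge_tree_set T') /\ regular (edge_tree_set T') /\
      tame (edge_tree_set T')) /\
     graph_isomorphic T' (tree_of (edge_tree_set T'))).
Proof.
have part2 (tau' : sep_structure) :
    tree_set tau' -> regular tau' -> tame tau' -> is_tree (tree_of tau') /\
    sep_isomorphic tau' (edge_tree_set (tree_of tau')).
  by split; [exact: tree_of_is_tree|exact: edge_tree_set_tree_of].
split; last split=> //.
  move=> tau treeT; split; last by case=> ? ?; exists (tree_of tau); exact: part2.
  move=> [T [treeG iso]].
  exact: sep_isomorphic_regular_tame iso (edge_regular treeG) (edge_tame treeG).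
move=> T' treeG; split; last exact: tree_of_edge_tree_set.
split; first exact: edge_tree_set_tree_set.
by split; [exact: edge_regular|exact: edge_tame].
Qed.
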